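(* For all integers $n, m$ with $n > m \geq 0$, $$C\left(K_{n+m}^{-K_m}\right) = \sum_{i=0}^{n-1}\binom{n-1}{i}\sum_{j=0}^{m}\binom{m}{j}\,C\left(K_{i+j}^{-K_j}\right).$$
   Context: All graphs are finite and simple. A graph composition of a graph $G$ is a partition of the vertex set $V(G)$ into nonempty blocks such that each block induces a connected subgraph of $G$. The composition number $C(G)$ is the number of graph compositions of $G$; for the graph with no vertices, $C=1$ (the empty partition). $K_n$ denotes the complete graph on $n$ vertices ($K_0$ is the graph with no vertices). For $0\le m\le n$, $K_n^{-K_m}$ denotes the graph on $n$ vertices obtained from $K_n$ by choosing $m$ of its vertices and deleting all edges joining two of the chosen vertices (well defined up to isomorphism). *)

(* Defs.v *)
From HB Require Import structures.
From mathcomp Require Import all_boot.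
Set Implicit Arguments.
Unset Strict Implicit.
Unset Printing Implicit Defensive.

Record sgraph := SGraph {
  vertex :> finType;
  edge : rel vertex;
  edge_sym : symmetric edge;
  edge_irrefl : irreflexive edge }.

Section Constructions.
Variable G : sgraph.

Definition induced_rel (B : {set G}) : rel {x : G | x \in B} :=
  [rel u v | edge (val u) (val v)].

Lemma induced_sym B : symmetric (@induced_rel B).
Proof. by move=> u v; apply: edge_sym. Qed.

Lemma induced_irrefl B : irreflexive (@induced_rel B).
Proof. by move=> u; apply: edge_irrefl. Qed.

Definition induced (B : {set G}) : sgraph :=
  SGraph (@induced_sym B) (@induced_irrefl B).

Definition delete_inside_rel (S : {set G}) : rel G :=
  [rel x y | edge x y && ~~ ((x \in S) && (y \in S))].

Lemma delete_inside_sym S : symmetric (delete_inside_rel S).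
Proof. by by move=> x y; rewrite /delete_inside_rel /= edge_sym [(x \in S) && _]andbC. Qed.

Lemma delete_inside_irrefl S : irreflexive (delete_inside_rel S).
Proof. by move=> x; rewrite /delete_inside_rel /= edge_irrefl. Qed.

Definition delete_inside (S : {set G}) : sgraph :=
  SGraph (delete_inside_sym S) (delete_inside_irrefl S).

(* The graph with no vertices counts as connected here; this is immaterial
   below, since the blocks of a partition are nonempty. *)
Definition connected_graph : bool :=
  [forall x : G, forall y : G, connect (@edge G) x y].

End Constructions.

Definition is_composition (G : sgraph) (P : {set {set G}}) : bool :=
  partition P [set: G] && [forall B in P, connected_graph (induced B)].

Definition composition_number (G : sgraph) : nat :=
  #|[set P : {set {set G}} | is_composition P]|.

Lemma complete_sym n : symmetric [rel x y : 'I_n | x != y].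
Proof. by move=> x y; rewrite /= eq_sym. Qed.

Lemma complete_irrefl n : irreflexive [rel x y : 'I_n | x != y].
Proof. by move=> x; rewrite /= eqxx. Qed.

Definition complete_graph (n : nat) : sgraph :=
  SGraph (@complete_sym n) (@complete_irrefl n).

(* The m chosen vertices are 0, ..., m - 1; meaningful for m <= n. *)
Definition complete_minus_complete (n m : nat) : sgraph :=
  @delete_inside (complete_graph n) [set x : 'I_n | x < m].

(* Main.v *)
Require Import Defs.
From HB Require Import structures.
From mathcomp Require Import all_boot.
Set Implicit Arguments.
Unset Strict Implicit.
Unset Printing Implicit Defensive.

(** Among the [n > 0] vertices outside the independent set pick one, [v]. It is
adjacent to every other vertex, so every vertex set containing [v] induces a
connected graph. A composition is therefore the same thing as an arbitrary
block [B] around [v] together with a composition of the graph induced on the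
complement of [B] ([count_compositions_block], [universal_connected]). That
complement [A] is an arbitrary set avoiding [v]; if it has [i] vertices outside
the independent set and [j] inside, the graph induced on it is a copy of
[complete_minus_complete (i + j) j] ([compositions_on_complete_minus]), and
there are ['C(n - 1, i) * 'C(m, j)] sets [A] with these two cardinals
([sum_subsets_setU_card]).

Compositions of induced subgraphs are counted inside the ambient graph, as
partitions of a vertex set [A] into connected blocks, so that removing a block
does not change the type of vertices; [compositions_on_embedding] converts such
a count into the composition number of a graph. *)

(** * Connectedness and graph maps *)

Lemma connected_image (G H : sgraph) (f : G -> H) :
  (forall y, exists x, f x = y) ->
  (forall x y, edge x y -> edge (f x) (f y)) ->
  connected_graph G -> connected_graph H.
Proof.
move=> f_surj f_edge /forallP G_conn.
apply/forallP=> y1; apply/forallP=> y2.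
have [x1 <-] := f_surj y1; have [x2 <-] := f_surj y2.
have /connectP[p x1p ->] := forallP (G_conn x1) x2.
apply/connectP; exists (map f p); last by rewrite last_map.
by rewrite path_map; apply: sub_path x1p => x y /f_edge.
Qed.

(** The restriction of an embedding to a vertex set is an isomorphism onto the
image, so connectedness passes along it and along its inverse. *)
Lemma connected_induced_imset (H G : sgraph) (f : H -> G) (B : {set H}) :
  injective f -> (forall x y, edge (f x) (f y) = edge x y) ->
  connected_graph (induced (f @: B)) = connected_graph (induced B).
Proof.
move=> f_inj f_edge.
pose g (u : {x | x \in B}) : {y | y \in f @: B} :=
  Sub (f (val u)) (imset_f f (valP u)).
have g_surj w : exists u, g u = w.
  case: w => y yB; have /imsetP[x xB def_y] := yB.
  by exists (Sub x xB); apply: val_inj.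
have g_inj : injective g.
  by move=> u w /(congr1 val) /= /f_inj; apply: val_inj.
have g_onto w : w \in codom g by have [u <-] := g_surj w; apply: codom_f.
apply/idP/idP.
  apply: (@connected_image (induced (f @: B)) (induced B)
            (fun w => iinv (g_onto w))).
    by move=> u; exists (g u); apply: g_inj; rewrite f_iinv.
  move=> w1 w2.
  have fK w : val w = f (val (iinv (g_onto w))).
    by rewrite -[in LHS](f_iinv (g_onto w)).
  rewrite -[edge w1 w2]/(edge (val w1) (val w2)) (fK w1) (fK w2).
  by rewrite f_edge.
apply: (@connected_image (induced B) (induced (f @: B)) g) => // u w.
by rewrite -[edge u w]/(edge (val u) (val w)) -f_edge.
Qed.

(** Any two vertices of the set are joined by a path through [v]. *)
Lemma universal_connected (G : sgraph) (v : G) (B : {set G}) :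
  (forall x, x != v -> edge v x) -> v \in B -> connected_graph (induced B).
Proof.
move=> v_univ vB; pose w : induced B := Sub v vB.
have conn_w x : connect (@edge (induced B)) w x.
  have [-> | ne_xw] := eqVneq x w; first exact: connect0.
  by apply: connect1; apply: v_univ; rewrite -val_eqE in ne_xw.
apply/forallP=> x; apply/forallP=> y; apply: connect_trans (conn_w y).
by rewrite (sym_connect_sym (@edge_sym (induced B))) conn_w.
Qed.

(** * Compositions of an induced subgraph *)

Definition compositions_on (G : sgraph) (A : {set G}) : {set {set {set G}}} :=
  [set P | partition P A && [forall B in P, connected_graph (induced B)]].

Lemma compositions_on_embedding (H G : sgraph) (f : H -> G) :
  injective f -> (forall x y, edge (f x) (f y) = edge x y) ->
  #|compositions_on (f @: [set: H])| = composition_number H.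
Proof.
move=> f_inj f_edge; pose F (P : {set {set H}}) :=
  [set f @: B | B : {set H} in P].
rewrite /composition_number.
have F_inj : injective F by apply: imset_inj; apply: imset_inj.
rewrite -(card_imset _ F_inj); apply: eq_card => Q.
have F_comp P :
    (F P \in compositions_on (f @: [set: H])) = is_composition P.
  rewrite inE imset_partition //; congr (_ && _).
  apply/forall_inP/forall_inP => conn B BP.
    by rewrite -(connected_induced_imset B f_inj f_edge) conn ?imset_f.
  have [C CP ->] := imsetP BP.
  by rewrite (connected_induced_imset C f_inj f_edge) conn.
apply/idP/imsetP => [Qcomp | [P]]; last by rewrite inE -F_comp => ? ->.
(* The blocks of Q lie in the range of f, so Q is the image of its preimage. *)
have defQ : Q = F [set f @^-1: B | B : {set G} in Q].
  rewrite /F -imset_comp -[LHS]imset_id; apply: eq_in_imset => B BQ /=.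
  have Qpart : partition Q (f @: [set: H]).
    by move: Qcomp; rewrite inE => /andP[].
  apply/setP=> y; apply/idP/imsetP => [yB | [x xB ->]].
    have /imsetP[x _ def_y] := subsetP (partitionS Qpart BQ) y yB.
    by exists x; rewrite // inE -def_y.
  by rewrite inE in xB.
by exists [set f @^-1: B | B : {set G} in Q]; rewrite // inE -F_comp -defQ.
Qed.

(** Deleting the block of [v] from a composition leaves a composition of the
remaining vertices, and any connected set around [v] can be put back. *)
Lemma count_compositions_block (G : sgraph) (A : {set G}) (v : G) :
  v \in A ->
  #|compositions_on A| =
  \sum_(B : {set G} | [&& B \subset A, v \in B & connected_graph (induced B)])
     #|compositions_on (A :\: B)|.
Proof.
move=> vA; rewrite -sum1_card (partition_big (pblock^~ v)
  (fun B => [&& B \subset A, v \in B & connected_graph (induced B)])); last first.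
  move=> P; rewrite inE => /andP[Ppart /forall_inP Pconn].
  have vP : v \in cover P by rewrite (cover_partition Ppart).
  rewrite mem_pblock vP Pconn ?pblock_mem // (partitionS Ppart) //.
  exact: pblock_mem.
apply: eq_bigr => B /and3P[BA vB Bconn]; rewrite sum1dep_card.
have notin_B P : P \in compositions_on (A :\: B) -> B \notin P.
  rewrite inE => /andP[Ppart _].
  apply/negP=> /(partitionS Ppart)/subsetP/(_ v vB).
  by rewrite inE vB.
have add_inj : {in compositions_on (A :\: B) &, injective (setU [set B])}.
  by move=> P Q /notin_B PB /notin_B QB /= eqPQ; rewrite -(setU1K PB) eqPQ setU1K.
rewrite -(card_in_imset add_inj); apply: eq_card => P; rewrite inE.
apply/andP/imsetP => [[] | [Q Qcomp ->]].
  rewrite inE => /andP[Ppart /forall_inP Pconn] /eqP defB.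
  have BP : B \in P by rewrite -defB pblock_mem // (cover_partition Ppart).
  exists (P :\ B); last by rewrite setD1K.
  rewrite inE partitionD1 //; apply/forall_inP=> C /setD1P[_]; exact: Pconn.
move: Qcomp; rewrite inE => /andP[Qpart /forall_inP Qconn].
have BQpart : partition (B |: Q) A.
  rewrite -(setID A B) (setIidPr BA) partitionU1 //.
    by apply/set0Pn; exists v.
  by rewrite disjoints_subset setCD subsetUr.
split; last by rewrite (def_pblock (partition_trivIset BQpart) (setU11 _ _) vB).
by rewrite inE BQpart; apply/forall_inP=> C /setU1P[-> // | /Qconn].
Qed.

(** Whatever its position, a vertex set induces a graph determined by how many
of its vertices lie in the independent set: list those vertices first. *)
Lemma compositions_on_complete_minus (n m : nat)
    (A : {set complete_minus_complete n m}) (S := [set x : 'I_n | x < m]) :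
  #|compositions_on A| =
  composition_number
    (complete_minus_complete (#|A :\: S| + #|A :&: S|) #|A :&: S|).
Proof.
set i := #|A :\: S|; set j := #|A :&: S|.
pose s := enum (A :&: S) ++ enum (A :\: S).
have size_s : size s = i + j by rewrite size_cat -!cardE addnC.
have uniq_s : uniq s.
  rewrite cat_uniq !enum_uniq andbT /=; apply/hasPn => x.
  by rewrite !mem_enum !inE; case: (x < m); rewrite ?andbF.
have mem_s x : (x \in s) = (x \in A).
  by rewrite mem_cat !mem_enum !inE; case: (x < m); rewrite ?andbF ?andbT ?orbF.
pose f (k : complete_minus_complete (i + j) j) :
  complete_minus_complete n m := tnth (Tuple (introT eqP size_s)) k.
have f_inj : injective f by apply/tuple_uniqP.
have fS k : (f k < m) = (k < j).
  have [d ->] : exists d, f k = nth d s k by exists (f k); apply: tnth_nth.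
  rewrite nth_cat -cardE -/j; case: (ltnP k j) => kj.
    have: nth d (enum (A :&: S)) k \in A :&: S.
      by rewrite -mem_enum mem_nth -?cardE.
    by rewrite !inE => /andP[].
  have: nth d (enum (A :\: S)) (k - j) \in A :\: S.
    by rewrite -mem_enum mem_nth // -cardE ltn_subLR // [j + _]addnC.
  by rewrite !inE => /andP[/negbTE].
have f_range : A = f @: [set: _].
  apply/setP=> x; rewrite -mem_s; apply/idP/imsetP => [xs | [k _ ->]].
    have [k def_x] := @tnthP _ _ (Tuple (introT eqP size_s)) _ xs.
    by exists k.
  exact: mem_tnth.
rewrite [in LHS]f_range compositions_on_embedding // => k l.
by rewrite /= /delete_inside_rel /= !inE !fS (inj_eq f_inj).
Qed.

(** * Sums over subsets *)

Lemma sum_subsets_card (T : finType) (X : {set T}) (g : nat -> nat) :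
  \sum_(A : {set T} | A \subset X) g #|A| =
  \sum_(0 <= i < #|X|.+1) 'C(#|X|, i) * g i.
Proof.
rewrite big_mkord.
rewrite (partition_big (fun A : {set T} => inord #|A| : 'I_#|X|.+1) xpredT) //=.
apply: eq_bigr => i _; rewrite -cards_draws -sum_nat_const.
apply: eq_big => [A | A]; last first.
  by move=> /andP[AX /eqP <-]; rewrite inordK // ltnS subset_leq_card.
rewrite inE; apply: andb_id2l => AX.
by rewrite -val_eqE /= inordK // ltnS subset_leq_card.
Qed.

Lemma setU_traces (T : finType) (X Y U W : {set T}) :
  [disjoint X & Y] -> U \subset X -> W \subset Y ->
  ((U :|: W) :&: X = U) * ((U :|: W) :&: Y = W).
Proof.
rewrite -setI_eq0 => /eqP XY0 UX WY.
have WX0 : W :&: X = set0.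
  by apply/eqP; rewrite -subset0 -XY0 setIC setIS.
have UY0 : U :&: Y = set0 by apply/eqP; rewrite -subset0 -XY0 setSI.
by rewrite !setIUl WX0 UY0 (setIidPl UX) (setIidPl WY) setU0 set0U.
Qed.

(** A subset of a disjoint union is a pair of subsets: its two traces. *)
Lemma sum_subsets_setU (T : finType) (X Y : {set T}) (F : {set T} -> nat) :
  [disjoint X & Y] ->
  \sum_(A : {set T} | A \subset X :|: Y) F A =
  \sum_(U : {set T} | U \subset X) \sum_(W : {set T} | W \subset Y) F (U :|: W).
Proof.
move=> disjXY; rewrite pair_big /=.
rewrite (reindex_onto (fun p : {set T} * {set T} => p.1 :|: p.2)
           (fun A => (A :&: X, A :&: Y))) /=; last first.
  by move=> A AXY; rewrite -setIUr (setIidPl AXY).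
apply: eq_bigl => -[U W] /=; apply/andP/andP => [[_ /eqP[<- <-]] | [UX WY]].
  by rewrite !subsetIr.
split; first by rewrite setUSS.
by rewrite !(setU_traces disjXY UX WY).
Qed.

Lemma sum_subsets_setU_card (T : finType) (X Y : {set T})
    (g : nat -> nat -> nat) :
  [disjoint X & Y] ->
  \sum_(A : {set T} | A \subset X :|: Y) g #|A :&: X| #|A :&: Y| =
  \sum_(0 <= i < #|X|.+1) 'C(#|X|, i) *
     \sum_(0 <= j < #|Y|.+1) 'C(#|Y|, j) * g i j.
Proof.
move=> disjXY; rewrite sum_subsets_setU //.
rewrite -(sum_subsets_card X (fun i => \sum_(0 <= j < _) 'C(_, j) * g i j)).
apply: eq_bigr => U UX; rewrite -sum_subsets_card; apply: eq_bigr => W WY.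
by rewrite !(setU_traces disjXY UX WY).
Qed.

Theorem theorem1 (n m : nat) (hmn : m < n) :
  composition_number (complete_minus_complete (n + m) m) =
  \sum_(0 <= i < n)
     'C(n - 1, i) *
     \sum_(0 <= j < m.+1)
        'C(m, j) * composition_number (complete_minus_complete (i + j) j).
Proof.
set G := complete_minus_complete (n + m) m.
have n_gt0 : 0 < n by apply: leq_ltn_trans hmn.
have m_lt : m < n + m by rewrite -[ltnLHS]add0n ltn_add2r.
(* Vertices are numbered so that the independent set is 0, ..., m - 1; hence m
   is a vertex outside it, as n > 0. *)
pose v : G := Ordinal m_lt; pose S : {set G} := [set x : 'I_(n + m) | x < m].
have vS : v \notin S by rewrite inE /= ltnn.
have v_univ x : x != v -> edge v x.
  by move=> ne_xv; rewrite /= /delete_inside_rel /= eq_sym ne_xv (negbTE vS).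
have cardS : #|S| = m.
  rewrite -[RHS]card_ord.
  have widen_inj : injective (widen_ord (ltnW m_lt)).
    by move=> x y /(congr1 val) /= /val_inj.
  rewrite -(card_imset _ widen_inj).
  apply: eq_card => x; rewrite inE; apply/idP/imsetP => [xm | [y _ ->]].
    by exists (Ordinal xm); last exact: val_inj.
  exact: ltn_ord y.
pose X : {set G} := ~: S :\ v.
have cardX : #|X| = n - 1.
  have := cardsD1 v (~: S).
  by rewrite inE vS cardsCs setCK card_ord cardS addnK => ->; rewrite subn1.
have disjXS : [disjoint X & S].
  by rewrite disjoints_subset subsetDl.
have XS : X :|: S = [set~ v].
  apply/setP=> x; rewrite !inE; case: eqVneq => [-> | _] /=; last exact: orNb.
  by rewrite ltnn.
have -> : composition_number G = #|compositions_on [set: G]|.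
  by apply: eq_card => P; rewrite !inE.
rewrite (count_compositions_block (in_setT v)).
(* Index by the complement of the block around v instead of the block. *)
rewrite (reindex_inj (inv_inj (@setCK _))) /=.
transitivity (\sum_(A : {set G} | A \subset X :|: S)
  composition_number
    (complete_minus_complete (#|A :&: X| + #|A :&: S|) #|A :&: S|)).
  apply: eq_big => A.
    rewrite subsetT XS subsets_disjoint setCK disjoint_sym disjoints1 inE /=.
    by apply: andb_idr => vA; apply: universal_connected v_univ _; rewrite inE.
  case/and3P=> _; rewrite inE => vA _.
  rewrite setTD setCK compositions_on_complete_minus -/S.
  suff -> : A :\: S = A :&: X by [].
  apply/setP=> x; rewrite !inE; have [-> | _] := eqVneq x v.
    by rewrite (negbTE vA) andbF.
  exact: andbC.
rewrite (sum_subsets_setU_card (fun i j =>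
  composition_number (complete_minus_complete (i + j) j)) disjXS).
by rewrite cardX cardS subn1 prednK.
Qed.
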